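(* Let $(X,d)$ be a complete metric space, let $k\in\mathbb{N}$, and let $T:\prod_{l=1}^{\infty}X\to X$ be an extended Fisher-Geraghty $H_k$ contraction. Then there exists $u\in X$ such that $T(u,u,u,\ldots)=u$, and for any $x_1,\ldots,x_k\in X$ the infinite $k$-Picard sequence with respect to $T$ based on $\{x_1,\ldots,x_k\}$ converges to $u$.
   Context: $\mathbb{N}$ denotes the set of positive integers; metric spaces are nonempty. $\prod_{l=1}^{\infty}X$ is the set of all infinite sequences of points of $X$. For points $u_1,\ldots,u_k\in X$, write $(u_{i,\widehat{k}})_{i=1}^{\infty}:=(u_1,u_2,\ldots,u_{k-1},u_k,u_k,u_k,\ldots)$, the infinite tuple in which the $k$-th point is repeated forever. $\mathbb{G}$ denotes the set of all functions $\beta:[0,\infty)\to[0,1)$ such that, for every sequence $(t_n)$ in $[0,\infty)$, $\lim_{n\to\infty}\beta(t_n)=1$ implies $\lim_{n\to\infty}t_n=0$. Extended Fisher-Geraghty $H_k$ contraction: $T:\prod_{l=1}^{\infty}X\to X$ is so called if there is $\beta\in\mathbb{G}$ such that for all $u_1,\ldots,u_k,v_1,\ldots,v_k\in X$, $$d\big(T((u_{i,\widehat{k}})_{i=1}^{\infty}),T((v_{i,\widehat{k}})_{i=1}^{\infty})\big)\le\frac{\beta(d(u_k,v_k))}{2}\Big(d\big(T((u_{i,\widehat{k}})_{i=1}^{\infty}),v_k\big)+d\big(T((v_{i,\widehat{k}})_{i=1}^{\infty}),u_k\big)\Big).$$ Infinite $k$-Picard sequence: given $T:\prod_{l=1}^{\infty}X\to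 X$ and base points $x_1,\ldots,x_k\in X$, it is the sequence defined recursively by $x_{n+k}:=T(x_n,x_{n+1},\ldots,x_{n+k-2},x_{n+k-1},x_{n+k-1},x_{n+k-1},\ldots)$ for all $n\ge1$ (the entry $x_{n+k-1}$ is repeated forever). *)

(* Defs.v *)
From HB Require Import structures.
From mathcomp Require Import all_boot all_order all_algebra.
From mathcomp Require Import all_classical all_reals all_analysis.

Set Implicit Arguments.
Unset Strict Implicit.
Unset Printing Implicit Defensive.

Import Order.TTheory GRing.Theory Num.Theory.
Import numFieldNormedType.Exports.

Local Open Scope classical_set_scope.
Local Open Scope ring_scope.

(* The library has metric spaces and complete (pointed, hence nonempty) uniform
   spaces, but no structure combining them. *)
#[short(type="completeMetricType")]
HB.structure Definition CompleteMetric (R : numDomainType) :=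
  {T of Complete T & Metric R T}.

(* Members of the class are maps [0, oo) -> [0, 1); they are represented by
   functions on R whose values at negative reals are irrelevant. *)
Definition geraghty (R : realType) (beta : R -> R) : Prop :=
  (forall t, 0 <= t -> 0 <= beta t < 1) /\
  (forall t : nat -> R, (forall n, 0 <= t n) ->
     beta (t n) @[n --> \oo] --> (1 : R) -> t n @[n --> \oo] --> (0 : R)).

Section Picard.
Variable X : pointedType.

(* Sequences are indexed from 0. The default value [point] is only reached when
   the finite tuple is empty. *)
Definition last_pt (s : seq X) : X := last point s.

(* (u_1, ..., u_k) |-> (u_1, ..., u_k, u_k, u_k, ...) *)
Definition extend (s : seq X) : nat -> X := nth (last_pt s) s.

(* (x_n, ..., x_(n+k-1)) |-> (x_(n+1), ..., x_(n+k)) *)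
Definition picard_step (T : (nat -> X) -> X) (s : seq X) : seq X :=
  rcons (behead s) (T (extend s)).

Definition picard (T : (nat -> X) -> X) (s : seq X) : nat -> X :=
  fun n => head point (iter n (picard_step T) s).

Lemma size_picard_window T (s : seq X) n : (0 < size s)%N ->
  size (iter n (picard_step T) s) = size s.
Proof.
move=> s0; elim: n => //= n IHn.
by rewrite size_rcons size_behead IHn prednK.
Qed.

Lemma nth_picard_window T (s : seq X) n i : (i < size s)%N ->
  nth point (iter n (picard_step T) s) i = picard T s (n + i).
Proof.
elim: i n => [|i IHi] n his; first by rewrite addn0 /picard nth0.
have s0 : (0 < size s)%N by exact: leq_trans his.
rewrite addnS -addSn -IHi ?(ltnW his)//= nth_rcons size_behead.
by rewrite size_picard_window// nth_behead ltn_predRL his.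
Qed.

Lemma picard_base T k (s : k.-tuple X) (i : 'I_k) : picard T s i = tnth s i.
Proof.
by rewrite -(add0n i) -nth_picard_window ?size_tuple//= -tnth_nth.
Qed.

Lemma picard_rec T k (s : k.-tuple X) n : (0 < k)%N ->
  picard T s (n + k) = T (extend [tuple picard T s (n + i) | i < k]).
Proof.
move=> k0; have s0 : (0 < size s)%N by rewrite size_tuple.
have -> : (n + k = n.+1 + k.-1)%N by rewrite addSnnS prednK.
rewrite -nth_picard_window ?size_tuple ?prednK//= nth_rcons size_behead.
rewrite size_picard_window// size_tuple ltnn eqxx; congr (T (extend _)).
apply: (@eq_from_nth _ point).
  by rewrite size_picard_window// !size_tuple card_ord.
move=> i; rewrite size_picard_window// size_tuple => ik.
rewrite nth_picard_window ?size_tuple// (nth_map (Ordinal ik)) ?size_enum_ord//.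
by rewrite nth_enum_ord.
Qed.

End Picard.

Definition extended_FG_H_contraction (R : realType) (X : completeMetricType R)
    (k : nat) (T : (nat -> X) -> X) : Prop :=
  exists beta : R -> R, geraghty beta /\
    forall u v : k.-tuple X,
      mdist (T (extend u)) (T (extend v)) <=
        beta (mdist (last_pt u) (last_pt v)) / 2 *
        (mdist (T (extend u)) (last_pt v) + mdist (T (extend v)) (last_pt u)).

(* Main.v *)
Require Import Defs.
From mathcomp Require Import all_boot all_order all_algebra.
From mathcomp Require Import all_classical all_reals all_analysis.
From mathcomp Require Import lra.

Import Order.TTheory GRing.Theory Num.Theory.
Import numFieldNormedType.Exports.

Local Open Scope classical_set_scope.
Local Open Scope ring_scope.

(** The contraction inequality sees a tuple only through its last point [a] and
    its image [a' = T (a_1, ..., a_k, a_k, ...)], so it is an inequality between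
    pairs [(a, a')] and [(b, b')]:
      [d(a', b') <= beta(d(a, b))/2 * (d(a', b) + d(b', a))].
    Bounding [d(a', b)] and [d(b', a)] by the triangle inequality through [a]
    and [b], and [d(a, b)] through [a'] and [b'], gives
      [(1 - beta(d(a, b))) * d(a, b) <= 3/2 * (d(a, a') + d(b, b'))].
    The Geraghty condition bounds [beta] away from 1 on every [[e, oo[], hence
    pairs with small displacement have first points close to each other
    ([approx_fixed_points_close]).

    The whole proof rests on this estimate.  The last points of the successive
    windows of a Picard sequence form an orbit [y n, y n.+1] of such pairs; its
    displacements tend to 0 ([orbit_displacement_cvg0]), so by the estimate it
    is Cauchy.  The limit [u] of one orbit is a fixed point
    ([orbit_limit_fixed]), and comparing any other orbit with the pair [(u, u)],
    whose displacement is 0, shows that it converges to [u] too. *)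

(** * Geraghty functions *)

(** Without such a [delta], points [t n >= e] with [beta (t n) > 1 - 1/(n+1)]
    would have to tend to 0. *)
Lemma geraghty_gap (R : realType) (beta : R -> R) (e : R) :
  geraghty beta -> 0 < e ->
  exists2 delta, 0 < delta & forall t, e <= t -> beta t <= 1 - delta.
Proof.
move=> [beta01 betaG] e0; apply: contrapT => nodelta.
have /choice[t tP] (n : nat) : exists t, e <= t /\ 1 - n.+1%:R^-1 < beta t.
  apply: contrapT => not; apply: nodelta; exists n.+1%:R^-1 => // t et.
  by rewrite leNgt; apply/negP => bt; apply: not; exists t.
have t0 n : 0 <= t n by exact: le_trans (ltW e0) (tP n).1.
have /(betaG _ t0)/cvgrPdist_lt/(_ e e0) : beta (t n) @[n --> \oo] --> (1 : R).
  apply: (@squeeze_cvgr _ _ _ _ (fun n => 1 - n.+1%:R^-1) (fun=> 1)).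
  - near=> n; rewrite (ltW (tP n).2)/=.
    by have /andP[_ /ltW] := beta01 _ (t0 n).
  - rewrite -[X in _ --> X]subr0; apply: cvgB; first exact: cvg_cst.
    exact: cvg_harmonic.
  - exact: cvg_cst.
move=> [N _ /(_ N (leqnn N))] /=.
by rewrite sub0r normrN ger0_norm// ltNge (tP N).1.
Unshelve. all: by end_near.
Qed.

(** * Contractive relations *)

(** Relations rather than maps: the image of a tuple is not determined by its
    last point. *)
Definition contractive_rel {R : realType} {X : metricType R}
    (beta : R -> R) (G : X -> X -> Prop) : Prop :=
  forall a a' b b', G a a' -> G b b' ->
    mdist a' b' <= beta (mdist a b) / 2 * (mdist a' b + mdist b' a).

(** With [D = d(a, b)] and [s] the sum of the displacements, the contraction
    gives [d(a', b') <= beta(D) * (D + s/2)], while [D <= s + d(a', b')]; so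
    [e <= D] forces [delta * e <= 3/2 * s]. *)
Lemma approx_fixed_points_close {R : realType} {X : metricType R}
    (beta : R -> R) (G : X -> X -> Prop) (e : R) :
  geraghty beta -> contractive_rel beta G -> 0 < e ->
  exists2 eta, 0 < eta & forall a a' b b', G a a' -> G b b' ->
    mdist a a' + mdist b b' < eta -> mdist a b < e.
Proof.
move=> betaG GC e0; have [delta delta0 gap] := geraghty_gap _ _ _ betaG e0.
exists (2 / 3 * delta * e); first by rewrite !mulr_gt0.
move=> a a' b b' Gaa' Gbb' small; rewrite ltNge; apply/negP => eD.
have bD := gap _ eD; have /andP[b0 _] := betaG.1 _ (mdist_ge0 a b).
have := GC _ _ _ _ Gaa' Gbb'.
have a'b := metric_triangle a' a b; have b'a := metric_triangle b' b a.
have ab := metric_triangle a a' b; have a'b2 := metric_triangle a' b' b.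
rewrite (metric_sym a' a) (metric_sym b' b) (metric_sym b a)
  in a'b b'a ab a'b2.
have := mdist_ge0 a a'; have := mdist_ge0 b b'.
move: (mdist a a') (mdist b b') (mdist a' b') (mdist a' b) (mdist b' a)
  (mdist a b) (beta _) small eD bD b0 a'b b'a ab a'b2.
move=> p q r s t D B small eD bD B0 h1 h2 h3 h4 q0 p0 hr.
have {}hr : r <= B * (D + (p + q) / 2).
  apply: le_trans hr _; rewrite -mulrA ler_wpM2l//; lra.
have {}hr : r <= (1 - delta) * (D + (p + q) / 2).
  by apply: le_trans hr _; rewrite ler_wpM2r//; lra.
have : delta * e <= delta * D by rewrite ler_pM2l.
have : 0 <= delta * (p + q) by rewrite mulr_ge0 ?addr_ge0// ltW.
lra.
Qed.

(** The inequality for consecutive pairs reads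
    [2 * d (n.+1) <= beta (d n) * (d n + d n.+1)] because one of its two cross
    terms vanishes.  So the displacements decrease, and by at least
    [delta * e] as long as they are at least [e], which happens finitely often. *)
Lemma orbit_displacement_cvg0 {R : realType} {X : metricType R}
    (beta : R -> R) (G : X -> X -> Prop) (y : nat -> X) (e : R) :
  geraghty beta -> contractive_rel beta G -> (forall n, G (y n) (y n.+1)) ->
  0 < e -> \forall n \near \oo, mdist (y n) (y n.+1) < e.
Proof.
move=> betaG GC Gy e0; pose d n := mdist (y n) (y n.+1).
have d0 n : 0 <= d n by exact: mdist_ge0.
have step n : 2 * d n.+1 <= beta (d n) * (d n + d n.+1).
  have := GC _ _ _ _ (Gy n) (Gy n.+1); rewrite mdistxx add0r -/(d n) -/(d n.+1).
  have /andP[b0 _] := betaG.1 _ (d0 n).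
  have := metric_triangle (y n) (y n.+1) (y n.+2).
  rewrite -/(d n) -/(d n.+1) (metric_sym (y n.+2))//.
  move=> /(ler_wpM2l b0) h1 h2; lra.
have [delta delta0 gap] := geraghty_gap _ _ _ betaG e0.
have dS n : d n.+1 <= d n.
  have /andP[b0 b1] := betaG.1 _ (d0 n).
  have := step n.
  have : beta (d n) * (d n + d n.+1) <= 1 * (d n + d n.+1).
    by rewrite ler_wpM2r ?addr_ge0// ltW.
  lra.
have drop n : e <= d n -> d n.+1 <= d n - delta * e.
  move=> ed; have := step n.
  have : beta (d n) * (d n + d n.+1) <= (1 - delta) * (d n + d n.+1).
    by rewrite ler_wpM2r ?addr_ge0// gap.
  have : delta * e <= delta * d n by rewrite ler_pM2l.
  have : 0 <= delta * d n.+1 by rewrite mulr_ge0// ltW.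
  lra.
have [N dN] : exists N, d N < e.
  apply: contrapT => nosmall.
  have ed n : e <= d n.
    by rewrite leNgt; apply/negP => ?; apply: nosmall; exists n.
  have lin n : d n <= d 0 - delta * e *+ n.
    elim: n => [|n IH]; first by rewrite mulr0n subr0.
    by rewrite mulrSr; have := drop n (ed n); lra.
  have de0 : 0 < delta * e by rewrite mulr_gt0.
  have := archi_boundP (divr_ge0 (d0 0) (ltW de0)).
  rewrite ltr_pdivrMr// mulr_natl => big.
  set m := Num.bound _ in big.
  by have := lin m; have := d0 m; lra.
exists N => // n /=; elim: n => [|n IH].
  by rewrite leqn0 => /eqP N0; rewrite N0 in dN.
rewrite leq_eqVlt => /predU1P[<-//|]; rewrite ltnS => /IH.
exact: le_lt_trans (dS n).
Qed.

Lemma orbit_cvg_fixed {R : realType} {X : metricType R}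
    (beta : R -> R) (G : X -> X -> Prop) (y : nat -> X) (u : X) :
  geraghty beta -> contractive_rel beta G -> (forall n, G (y n) (y n.+1)) ->
  G u u -> y n @[n --> \oo] --> u.
Proof.
move=> betaG GC Gy Gu; apply/metricType_numDomainType.cvgrPdist_lt => e e0.
have [eta eta0 close] := approx_fixed_points_close _ _ _ betaG GC e0.
apply: filterS (orbit_displacement_cvg0 _ _ _ _ betaG GC Gy eta0) => n yn.
by apply: (close u u (y n) (y n.+1)) => //; rewrite mdistxx add0r.
Qed.

Lemma orbit_cvg {R : realType} {X : completeMetricType R}
    (beta : R -> R) (G : X -> X -> Prop) (y : nat -> X) :
  geraghty beta -> contractive_rel beta G -> (forall n, G (y n) (y n.+1)) ->
  exists u : X, y n @[n --> \oo] --> u.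
Proof.
move=> betaG GC Gy.
apply/cvg_ex/cauchy_cvgP/cauchy_exP => e e0.
have [eta eta0 close] := approx_fixed_points_close _ _ _ betaG GC e0.
have eta20 : 0 < eta / 2 by rewrite divr_gt0.
have [N _ small] := orbit_displacement_cvg0 _ _ _ _ betaG GC Gy eta20.
exists (y N); exists N => // n Nn; rewrite ballEmdist/=.
apply: (close _ (y N.+1) _ (y n.+1)) => //.
by have := small N (leqnn N); have := small n Nn => /=; lra.
Qed.

(** In the limit the contraction along the orbit reads
    [d(u, u') <= (d(u, u) + d(u', u)) / 2] because [beta <= 1]. *)
Lemma orbit_limit_fixed {R : realType} {X : metricType R}
    (beta : R -> R) (G : X -> X -> Prop) (y : nat -> X) (u u' : X) :
  geraghty beta -> contractive_rel beta G -> (forall n, G (y n) (y n.+1)) ->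
  y n @[n --> \oo] --> u -> G u u' -> u' = u.
Proof.
move=> betaG GC Gy yu Gu; apply/eqP; rewrite -[_ == _]negbK -mdist_gt0.
apply/negP => e0; have e40 : 0 < mdist u' u / 4 by rewrite divr_gt0.
have [N _ near] := metricType_numDomainType.cvgr_dist_lt yu e40.
have h1 := near N (leqnn N); have h2 := near N.+1 (leqnSn N).
have := GC _ _ _ _ (Gy N) Gu.
have /andP[_ /ltW b1] := betaG.1 _ (mdist_ge0 (y N) u).
set s := _ + _ => h3.
have {}h3 : mdist (y N.+1) u' <= 1 / 2 * s.
  by apply: le_trans h3 _; rewrite ler_wpM2r ?addr_ge0 ?mdist_ge0// ler_pM2r.
have := metric_triangle u' (y N.+1) u.
have := metric_triangle u' u (y N).
rewrite /s (metric_sym u' (y N.+1)) (metric_sym (y N.+1) u) in h3 *.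
move: h1 h2 => /=; lra.
Qed.

(** * Picard sequences *)

(** The pairs [(a, a')] that the contraction inequality compares. *)
Definition window_rel {X : pointedType} (k : nat) (T : (nat -> X) -> X)
    (a a' : X) : Prop :=
  exists2 s : k.-tuple X, a = last_pt s & a' = T (extend s).

(** The first [k - 1] base points are never the last point of a window, whence
    the shift of the index. *)
Lemma last_picard_window {X : pointedType} (T : (nat -> X) -> X) (s : seq X)
    (n : nat) : (0 < size s)%N ->
  last_pt (iter n (picard_step T) s) = picard T s (n + (size s).-1).
Proof.
move=> s0; rewrite -nth_picard_window ?prednK//.
by rewrite -(size_picard_window T n s0) nth_last.
Qed.

Lemma picard_orbit {X : pointedType} (k : nat) (T : (nat -> X) -> X)
    (x : k.-tuple X) (n : nat) : (0 < k)%N ->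
  window_rel k T (picard T x (n + k.-1)) (picard T x (n.+1 + k.-1)).
Proof.
move=> k0; have x0 : (0 < size x)%N by rewrite size_tuple.
have sz : size (iter n (picard_step T) x) == k.
  by rewrite size_picard_window// size_tuple.
have lastE m : picard T x (m + k.-1) = last_pt (iter m (picard_step T) x).
  by rewrite last_picard_window// size_tuple.
by rewrite !lastE; exists (Tuple sz) => //=; rewrite /last_pt last_rcons.
Qed.

Lemma window_rel_const {X : pointedType} (k : nat) (T : (nat -> X) -> X)
    (u : X) : (0 < k)%N -> window_rel k T u (T (fun=> u)).
Proof.
move=> k0; have lastu : last_pt (nseq k u) = u by case: k k0 => // k _; elim: k.
exists (nseq_tuple k u); rewrite //=; congr T; apply/funext => i.
by rewrite /extend lastu nth_nseq if_same.
Qed.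

Theorem theorem2p3 (R : realType) (X : completeMetricType R) (k : nat)
  (k_gt0 : (0 < k)%N) (T : (nat -> X) -> X)
  (T_contraction : extended_FG_H_contraction k T) :
  exists u : X, T (fun=> u) = u /\
    forall x : k.-tuple X, picard T x n @[n --> \oo] --> u.
Proof.
have [beta [betaG TC]] := T_contraction.
have GC : contractive_rel beta (window_rel k T).
  by move=> _ _ _ _ [s -> ->] [t -> ->]; exact: TC.
have orbit (x : k.-tuple X) n := picard_orbit k T x n k_gt0.
pose y n := picard T (nseq_tuple k (point : X)) (n + k.-1).
have [u yu] := orbit_cvg beta _ y betaG GC (orbit _).
have Tu : T (fun=> u) = u.
  exact: orbit_limit_fixed betaG GC (orbit _) yu (window_rel_const k T u k_gt0).
exists u; split=> // x; rewrite -(cvg_shiftn k.-1).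
apply: orbit_cvg_fixed betaG GC (orbit x) _.
by rewrite -{2}Tu; exact: window_rel_const.
Qed.
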